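(* Let $x,y\in\mathcal V=\bigcup_{n\ge1}\mathbb R^n$. Then $d_{\mathcal V}(x,y)=0$ if and only if $x\leftrightarrow y$.
   Context: $\mathcal V=\bigcup_{n=1}^\infty \mathbb R^n$ (disjoint union, column vectors). $\mathbf 1_k\in\mathbb R^k$ is the all-ones vector, $\otimes$ the Kronecker product. For $x\in\mathbb R^m$, $y\in\mathbb R^n$ and $t=\mathrm{lcm}(m,n)$: $x\,\vec{+}\,y:=(x\otimes \mathbf 1_{t/m})+(y\otimes \mathbf 1_{t/n})\in\mathbb R^t$; $x\,\vec{\vdash}\,y:=x\,\vec{+}\,(-y)$; $\langle x,y\rangle_{\mathcal V}:=\frac1t\langle x\otimes \mathbf 1_{t/m},\,y\otimes \mathbf 1_{t/n}\rangle$; $\|x\|_{\mathcal V}:=\sqrt{\langle x,x\rangle_{\mathcal V}}$; $d_{\mathcal V}(x,y):=\|x\,\vec{\vdash}\,y\|_{\mathcal V}$. Equivalence: $x\leftrightarrow y$ if there exist positive integers $\alpha,\beta$ with $x\otimes \mathbf 1_\alpha=y\otimes \mathbf 1_\beta$. *)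

(* Defs.v *)
From mathcomp Require Import all_boot all_order all_algebra.
From mathcomp Require Import reals.
From mathcomp Require Export mxtens.

Set Implicit Arguments.
Unset Strict Implicit.
Unset Printing Implicit Defensive.

Import Order.TTheory GRing.Theory Num.Theory.
Local Open Scope ring_scope.

(* The disjoint union of the spaces R^n, n >= 1. Positivity of the dimension  *)
(* is a boolean statement, hence proof-irrelevant, so that equality in mvec R *)
(* means equal dimensions and equal entries.                                  *)
Record mvec (R : realType) := MVec {
  mdim : nat;
  mdim_gt0 : (0 < mdim)%N;
  mvecval : 'cV[R]_mdim
}.

Lemma muln_gt0_proof m n : (0 < m)%N -> (0 < n)%N -> (0 < m * n)%N.
Proof. by rewrite muln_gt0 => -> ->. Qed.

Lemma lcmn_gt0_proof m n : (0 < m)%N -> (0 < n)%N -> (0 < lcmn m n)%N.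
Proof. by rewrite lcmn_gt0 => -> ->. Qed.

Lemma lcmn_muldivl m n : (m * (lcmn m n %/ m))%N = lcmn m n.
Proof. by rewrite mulnC divnK // dvdn_lcml. Qed.

Lemma lcmn_muldivr m n : (n * (lcmn m n %/ n))%N = lcmn m n.
Proof. by rewrite mulnC divnK // dvdn_lcmr. Qed.

Section MixedDimension.
Variable R : realType.
Implicit Types x y : mvec R.

Definition ones (k : nat) : 'cV[R]_k := const_mx 1.

(* The Kronecker product u (x) 1_k; its 1 * 1 columns are read as 1 column.   *)
Definition kron_ones (m : nat) (u : 'cV[R]_m) (k : nat) : 'cV[R]_(m * k) :=
  tensmx u (ones k).

(* With t = lcm(dim x, dim y), these are x (x) 1_{t/dim x} and                *)
(* y (x) 1_{t/dim y}, both transported to R^t.                                *)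
Definition lcm_liftl x y : 'cV[R]_(lcmn (mdim x) (mdim y)) :=
  castmx (lcmn_muldivl (mdim x) (mdim y), erefl 1%N)
    (kron_ones (mvecval x) (lcmn (mdim x) (mdim y) %/ mdim x)).

Definition lcm_liftr x y : 'cV[R]_(lcmn (mdim x) (mdim y)) :=
  castmx (lcmn_muldivr (mdim x) (mdim y), erefl 1%N)
    (kron_ones (mvecval y) (lcmn (mdim x) (mdim y) %/ mdim y)).

Definition mvec_add x y : mvec R :=
  MVec (lcmn_gt0_proof (mdim_gt0 x) (mdim_gt0 y))
    (lcm_liftl x y + lcm_liftr x y).

Definition mvec_opp x : mvec R := MVec (mdim_gt0 x) (- mvecval x).

Definition mvec_sub x y : mvec R := mvec_add x (mvec_opp y).

Definition dot (n : nat) (u v : 'cV[R]_n) : R := \sum_(i < n) u i 0 * v i 0.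

Definition mvec_inner x y : R :=
  (lcmn (mdim x) (mdim y))%:R^-1 * dot (lcm_liftl x y) (lcm_liftr x y).

Definition mvec_norm x : R := Num.sqrt (mvec_inner x x).

Definition mvec_dist x y : R := mvec_norm (mvec_sub x y).

Definition mvec_kron_ones x (k : nat) (k_gt0 : (0 < k)%N) : mvec R :=
  MVec (muln_gt0_proof (mdim_gt0 x) k_gt0) (kron_ones (mvecval x) k).

Definition mvec_equiv x y : Prop :=
  exists (a b : nat) (a_gt0 : (0 < a)%N) (b_gt0 : (0 < b)%N),
    mvec_kron_ones x a_gt0 = mvec_kron_ones y b_gt0.

End MixedDimension.

(* Main.v *)
Require Import Defs.
From mathcomp Require Import all_boot all_order all_algebra.
From mathcomp Require Import reals.

Set Implicit Arguments.
Unset Strict Implicit.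
Unset Printing Implicit Defensive.

Import Order.TTheory GRing.Theory Num.Theory.
Local Open Scope ring_scope.

(** Extend a vector to all of [nat]; then [u (x) 1_k] is [i |-> u (i %/ k)],
    with no transport between dimensions. The distance vanishes iff the two
    lifts to dimension [t = lcm (m, n)] agree, which is an equivalence between
    [x] and [y]; conversely, if [x (x) 1_a = y (x) 1_b] then [m * a = n * b] is
    a multiple [t * c] of [t], and the [i]-th entries of the lifts are the
    [(i * c)]-th entries of [x (x) 1_a] and [y (x) 1_b]. *)

Lemma lcmn_divl_gt0 m n : (0 < m)%N -> (0 < n)%N -> (0 < lcmn m n %/ m)%N.
Proof.
by move=> m0 n0; rewrite divn_gt0 // dvdn_leq ?dvdn_lcml // lcmn_gt0 m0.
Qed.

Lemma lcmn_divr_gt0 m n : (0 < m)%N -> (0 < n)%N -> (0 < lcmn m n %/ n)%N.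
Proof. by move=> m0 n0; rewrite lcmnC lcmn_divl_gt0. Qed.

Section Entries.
Variable R : realType.
Implicit Types x y s : mvec R.

(** Indexing by [nat] lets vectors whose dimensions are only provably equal be compared without a
    cast. *)
Definition entry (m : nat) (u : 'cV[R]_m) (i : nat) : R :=
  if insub i is Some j then u j 0 else 0.

Lemma entry_ord m (u : 'cV[R]_m) (j : 'I_m) : entry u j = u j 0.
Proof. by rewrite /entry valK. Qed.

Lemma entry_out m (u : 'cV[R]_m) i : (m <= i)%N -> entry u i = 0.
Proof. by move=> le_mi; rewrite /entry insubN // -leqNgt. Qed.

Lemma entry_inj m (u v : 'cV[R]_m) : entry u =1 entry v -> u = v.
Proof. by move=> uv; apply/colP => j; rewrite -!entry_ord. Qed.

Lemma entryN m (u : 'cV[R]_m) i : entry (- u) i = - entry u i.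
Proof. by rewrite /entry; case: insub => [j|]; rewrite ?mxE ?oppr0. Qed.

Lemma entry_castmx m n (e : (m = n) * (1 = 1)%N) (u : 'cV[R]_m) :
  entry (castmx e u) =1 entry u.
Proof.
by case: e => e1 e2; case: n / e1 => i; rewrite (eq_irrelevance e2 erefl).
Qed.

(** This holds for every [i]: since [m * k <= i] exactly when [m <= i %/ k], both sides leave their
    range together and take the default value 0. *)
Lemma entry_kron_ones m (u : 'cV[R]_m) k i : (0 < k)%N ->
  entry (kron_ones u k) i = entry u (i %/ k).
Proof.
move=> k_gt0; have [lt_i|le_i] := ltnP i (m * k); last first.
  by rewrite !entry_out // leq_divRL.
have lt_ik : (i %/ k < m)%N by rewrite ltn_divLR.
rewrite (entry_ord _ (Ordinal lt_i)) (entry_ord _ (Ordinal lt_ik)) !mxE mulr1.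
by congr (u _ _); [apply: val_inj | rewrite ord1].
Qed.

Lemma entry_lcm_liftl x y i :
  entry (lcm_liftl x y) i =
  entry (mvecval x) (i %/ (lcmn (mdim x) (mdim y) %/ mdim x)).
Proof.
by rewrite entry_castmx entry_kron_ones // lcmn_divl_gt0 ?mdim_gt0.
Qed.

Lemma entry_lcm_liftr x y i :
  entry (lcm_liftr x y) i =
  entry (mvecval y) (i %/ (lcmn (mdim x) (mdim y) %/ mdim y)).
Proof.
by rewrite entry_castmx entry_kron_ones // lcmn_divr_gt0 ?mdim_gt0.
Qed.

(** Once the dimensions are identified, the positivity proofs agree because they are boolean
    equalities. *)
Lemma mvec_eqP x y :
  x = y <-> mdim x = mdim y /\ entry (mvecval x) =1 entry (mvecval y).
Proof.
split=> [->|] //; case: x y => m m_gt0 u [n n_gt0 v] /= [e].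
case: n / e => /= in n_gt0 v *.
by move=> /entry_inj ->; rewrite (bool_irrelevance m_gt0 n_gt0).
Qed.

Lemma dot_eq0 n (u : 'cV[R]_n) : dot u u = 0 <-> u = 0.
Proof.
split=> [/eqP|->]; last by rewrite /dot big1 // => i _; rewrite mxE mul0r.
rewrite psumr_eq0 => [/allP u0|i _]; last by rewrite -expr2 sqr_ge0.
apply/colP => i; rewrite mxE; apply/eqP.
by have := u0 i (mem_index_enum i); rewrite mulf_eq0 orbb.
Qed.

(** The sides differ only in the equality proof used by the cast. This makes [mvec_inner s s] a
    scaled sum of squares. *)
Lemma lcm_lift_diag s : lcm_liftl s s = lcm_liftr s s.
Proof. by apply: entry_inj => i; rewrite entry_lcm_liftl entry_lcm_liftr. Qed.

Lemma mvec_norm_eq0 s : mvec_norm s = 0 <-> mvecval s = 0.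
Proof.
have lift0 : lcm_liftl s s = 0 <-> mvecval s = 0.
  (* Since lcm(n, n) / n = 1, the lift repeats each entry once. *)
  have E i : entry (lcm_liftl s s) i = entry (mvecval s) i.
    by rewrite entry_lcm_liftl (lcmn_idPl (dvdnn _)) divnn mdim_gt0 divn1.
  have entry0 m i : entry (0 : 'cV[R]_m) i = 0.
    by rewrite /entry; case: insub => [j|]; rewrite ?mxE.
  by split=> s0; apply: entry_inj => i; [rewrite -E | rewrite E];
     rewrite s0 !entry0.
rewrite -lift0 -dot_eq0 /mvec_norm /mvec_inner -lcm_lift_diag.
have dot_ge0 : 0 <= dot (lcm_liftl s s) (lcm_liftl s s).
  by apply: sumr_ge0 => i _; rewrite -expr2 sqr_ge0.
have t_neq0 : (lcmn (mdim s) (mdim s))%:R != 0 :> R.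
  by rewrite pnatr_eq0 -lt0n lcmn_gt0 mdim_gt0.
split=> [/eqP|->]; last by rewrite mulr0 sqrtr0.
(* [Num.sqrt] vanishes on all nonpositive numbers, so a zero norm only bounds the dot product above
   by 0; [dot_ge0] gives the other bound. *)
rewrite sqrtr_eq0 pmulr_rle0 ?invr_gt0 ?lt0r ?t_neq0 ?ler0n // => dot_le0.
by apply/eqP; rewrite eq_le dot_le0.
Qed.

Lemma mvec_dist_eq0 x y : mvec_dist x y = 0 <-> lcm_liftl x y = lcm_liftr x y.
Proof.
(* The left lift sees [y] only through its dimension, which [mvec_opp] keeps by definition. *)
have liftE : lcm_liftl x (mvec_opp y) = lcm_liftl x y by [].
have liftN : lcm_liftr x (mvec_opp y) = - lcm_liftr x y.
  by apply: entry_inj => i; rewrite entryN (entry_lcm_liftr x y)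
     (entry_lcm_liftr x (mvec_opp y)) entryN.
rewrite /mvec_dist mvec_norm_eq0 /= liftE liftN.
by split=> [/eqP|->]; [rewrite subr_eq0 => /eqP | rewrite subrr].
Qed.

End Entries.

Theorem mainTheorem4 (R : realType) (x y : mvec R) :
  mvec_dist x y = 0 <-> mvec_equiv x y.
Proof.
rewrite mvec_dist_eq0; set t := lcmn (mdim x) (mdim y).
have a_gt0 : (0 < t %/ mdim x)%N by rewrite lcmn_divl_gt0 ?mdim_gt0.
have b_gt0 : (0 < t %/ mdim y)%N by rewrite lcmn_divr_gt0 ?mdim_gt0.
split=> [lifts_eq|[a [b [a0 [b0 /mvec_eqP[/= dim_eq val_eq]]]]]].
  exists (t %/ mdim x)%N, (t %/ mdim y)%N, a_gt0, b_gt0.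
  apply/mvec_eqP; split=> [|i] /=; first by rewrite lcmn_muldivl lcmn_muldivr.
  by rewrite !entry_kron_ones // -entry_lcm_liftl -entry_lcm_liftr lifts_eq.
have /dvdnP[c Nc] : (t %| mdim x * a)%N.
  by rewrite dvdn_lcm dvdn_mulr //= dim_eq dvdn_mulr.
have c_gt0 : (0 < c)%N.
  by move: (muln_gt0_proof (mdim_gt0 x) a0); rewrite Nc muln_gt0 => /andP[].
(* Cancel [mdim x] in [mdim x * a = t * c], with [t] written as [mdim x * (t %/ mdim x)]. *)
have aE : a = (t %/ mdim x * c)%N.
  apply/eqP; rewrite -(eqn_pmul2l (mdim_gt0 x)) mulnA lcmn_muldivl Nc.
  by rewrite mulnC.
have bE : b = (t %/ mdim y * c)%N.
  apply/eqP; rewrite -(eqn_pmul2l (mdim_gt0 y)) mulnA lcmn_muldivr -dim_eq Nc.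
  by rewrite mulnC.
apply: entry_inj => i; rewrite entry_lcm_liftl entry_lcm_liftr.
(* The positive factor [c] cancels in both index quotients, leaving those of the two lifts. *)
have := val_eq (i * c)%N; rewrite !entry_kron_ones // aE bE.
by rewrite !divnMr.
Qed.
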